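(* For each pair of objects $[m]$ and $[n]$ ($m,n\ge 0$), the assignments $\sigma\mapsto F_\sigma$ and $F\mapsto \sigma_F$ induce mutually inverse correspondences between order-preserving surjections $[n]\twoheadrightarrow[m]$ and isomorphism classes of boundary-labelled height-one ordered forests $[m]\to F\leftarrow[n]$.
   Context: An ordered quiver is a triple $(P,\leq_P,\preceq_P)$ consisting of a finite set $P$, a partial order $\leq_P$ and a total order $\preceq_P$ on $P$ such that $x\leq_P y$ implies $x\preceq_P y$. Morphisms are set maps preserving both orders; the category is $\mathbf{Quiv}$. Put $L_P(x)=\{y\in P\mid y\leq_P x\}$. A subset $I$ of a poset is an interval if $a\leq c\leq b$ with $a,b\in I$ implies $c\in I$. An ordered forest is an ordered quiver such that $L_P(x)$ is an interval in $(P,\preceq_P)$ for every $x\in P$; an ordered tree is an ordered forest whose partial order has a unique maximal element. Every ordered forest $P$ is the ordered disjoint union (disjoint union of partial orders, ordinal sum of total orders, denoted $\oplus$) of its ordered tree components $L_P(r)$, $r\in\max(P)$. Here $\max(P)$, $\min(P)$ are the sets of maximal and minimal elements for $\leq_P$. An ordered tree is of height-one if every element is either minimal or maximal; equivalently, it has a unique maximal element and every other element is minimal. An ordered forest is called height-one if each of its ordered tree components is height-one. For $n\ge 0$, $[n]=\{0,\dots,n\}$ has its natural total order and the trivial (discrete) partial order. A boundary-labelled ordered forest from $[m]$ to $[n]$ is a cospan $[m]\xrightarrow{\iota^+}F\xleftarrow{\iota^-}[n]$ in $\mathbf{Quiv}$ with $F$ an ordered forest such that $\iota^+$ identifies $[m]$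 with $\max(F)$ and $\iota^-$ identifies $[n]$ with $\min(F)$, both with the total orders induced by $\preceq_F$. Two such, $(F,\iota^\pm)$ and $(F',\jmath^\pm)$, are isomorphic if there is an isomorphism $\alpha:F\to F'$ in $\mathbf{Quiv}$ with $\alpha\iota^+=\jmath^+$ and $\alpha\iota^-=\jmath^-$. For an order-preserving surjection $\sigma:[n]\twoheadrightarrow[m]$, put $B_i=\sigma^{-1}(i)$ for $0\le i\le m$; each $B_i$ is a nonempty interval and $[n]=B_0\oplus\cdots\oplus B_m$. Let $T_i$ be the height-one ordered tree whose unique maximal element is denoted $r_i$ and whose minimal elements are indexed, in their induced order, by the elements of $B_i$. Set $F_\sigma:=T_0\oplus\cdots\oplus T_m$, where the ordered set of maximal elements is identified with $[m]$ via $i\mapsto r_i$ and the ordered set of minimal elements is canonically identified with $[n]$. For a boundary-labelled ordered forest $[m]\xrightarrow{\iota^+}F\xleftarrow{\iota^-}[n]$, the map $\sigma_F:[n]\to[m]$ is the order-preserving surjection given by $\sigma_F(j)=i\iff \iota^-(j)\leq_F\iota^+(i)$.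
   Formalization: ''Either minimal or maximal'' in the definition of height-one is read exclusively, so one-element trees are not height-one; otherwise for m=n=0 the one-element tree and the two-element chain would be non-isomorphic with the same surjection. *)

(* Defs.v *)
From mathcomp Require Import all_boot.
Set Implicit Arguments.
Unset Strict Implicit.
Unset Printing Implicit Defensive.

Record quiver := Quiver {
  qsort :> finType;
  qle : rel qsort;
  qtot : rel qsort;
  qle_refl : reflexive qle;
  qle_anti : antisymmetric qle;
  qle_trans : transitive qle;
  qtot_total : total qtot;
  qtot_anti : antisymmetric qtot;
  qtot_trans : transitive qtot;
  qle_qtot : subrel qle qtot
}.

Record qhom (P Q : quiver) := QHom {
  qfun :> P -> Q;
  qhom_le : {homo qfun : x y / qle x y};
  qhom_tot : {homo qfun : x y / qtot x y}
}.

Definition qiso (P Q : quiver) (f : qhom P Q) : Prop :=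
  exists g : qhom Q P, cancel f g /\ cancel g f.

Definition maxs (P : quiver) : {set P} :=
  [set x | [forall y, qle x y ==> (y == x)]].

Definition mins (P : quiver) : {set P} :=
  [set x | [forall y, qle y x ==> (y == x)]].

Definition lower (P : quiver) (x : P) : {set P} := [set y | qle y x].

Definition is_interval (T : finType) (r : rel T) (I : {set T}) : Prop :=
  forall a b c, a \in I -> b \in I -> r a c -> r c b -> c \in I.

Definition ordered_forest (P : quiver) : Prop :=
  forall x : P, is_interval (@qtot P) (lower x).

Definition ordered_tree (P : quiver) : Prop :=
  ordered_forest P /\ exists r : P, maxs P = [set r].

Section SubQuiver.
Variables (P : quiver) (A : {set P}).
Definition sub_sort : finType := {x : P | x \in A}.
Definition sub_le : rel sub_sort := fun x y => qle (val x) (val y).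
Definition sub_tot : rel sub_sort := fun x y => qtot (val x) (val y).

Fact sub_le_refl : reflexive sub_le. Proof. by move=> x; exact: qle_refl. Qed.
Fact sub_le_anti : antisymmetric sub_le.
Proof. by move=> x y /qle_anti /val_inj. Qed.
Fact sub_le_trans : transitive sub_le.
Proof. by move=> y x z; exact: qle_trans. Qed.
Fact sub_tot_total : total sub_tot. Proof. by move=> x y; exact: qtot_total. Qed.
Fact sub_tot_anti : antisymmetric sub_tot.
Proof. by move=> x y /qtot_anti /val_inj. Qed.
Fact sub_tot_trans : transitive sub_tot.
Proof. by move=> y x z; exact: qtot_trans. Qed.
Fact sub_le_tot : subrel sub_le sub_tot. Proof. by move=> x y; exact: qle_qtot. Qed.

Definition subquiver : quiver :=
  Quiver sub_le_refl sub_le_anti sub_le_trans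
         sub_tot_total sub_tot_anti sub_tot_trans sub_le_tot.
End SubQuiver.

(* "Either minimal or maximal" is exclusive, so the one-element tree, whose   *)
(* only element is both, has height zero. Were it admitted, it and the        *)
(* two-element chain would be non-isomorphic forests from [0] to [0] with the *)
(* same surjection.                                                           *)
Definition height_one_tree (P : quiver) : Prop :=
  ordered_tree P /\ forall x : P, (x \in mins P) (+) (x \in maxs P).

Definition height_one_forest (P : quiver) : Prop :=
  ordered_forest P /\
  forall r : P, r \in maxs P -> height_one_tree (subquiver (lower r)).

Lemma height_oneI (P : quiver) :
  ordered_forest P -> (forall x : P, (x \in mins P) (+) (x \in maxs P)) ->
  height_one_forest P.
Proof.
move=> forP h; split=> // r; rewrite inE => /forallP rmax; split.
  split=> [x a b c|].
    by rewrite !inE; have := forP (val x) (val a) (val b) (val c); rewrite !inE.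
  have rr : r \in lower r by rewrite inE qle_refl.
  exists (Sub r rr); apply/setP=> x; rewrite !inE.
  apply/forallP/eqP => [/(_ (Sub r rr))/implyP xmax|-> y].
    by apply/esym/eqP/xmax; have := valP x; rewrite inE.
  by apply/implyP => /(implyP (rmax _)); rewrite -val_eqE.
move=> x; have xr : qle (val x) r by have := valP x; rewrite inE.
rewrite (_ : (x \in mins _) = (val x \in mins P)).
  rewrite (_ : (x \in maxs _) = (val x \in maxs P)); first exact: h.
  rewrite !inE; apply/forallP/forallP => hx y; apply/implyP => xy.
    have rr : r \in lower r by rewrite inE qle_refl.
    have /eqP e := implyP (hx (Sub r rr)) xr.
    by have := rmax y; rewrite -e /= in xy *; rewrite xy.
  by rewrite -val_eqE; exact: (implyP (hx (val y))).
rewrite !inE; apply/forallP/forallP => hx y; apply/implyP => yx.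
  have yr : y \in lower r by rewrite inE (qle_trans yx).
  by have := implyP (hx (Sub y yr)) yx; rewrite -val_eqE.
by rewrite -val_eqE; exact: (implyP (hx (val y))).
Qed.

Lemma lower_lt (P : quiver) (x y : P) :
  qle x y -> #|lower y| <= #|lower x| -> y = x.
Proof.
move=> xy le; have sub : lower x \subset lower y.
  by apply/subsetP=> z; rewrite !inE => /qle_trans; exact.
have /eqP e : lower x == lower y by rewrite eqEcard sub.
have : y \in lower x by rewrite e inE qle_refl.
by rewrite inE => yx; apply: qle_anti; rewrite xy yx.
Qed.

Lemma exists_max (P : quiver) (x : P) : exists2 r, r \in maxs P & qle x r.
Proof.
case: (@arg_maxnP _ x (fun y => qle x y) (fun y => #|lower y|) (qle_refl x)) => r xr rmax.
exists r => //; rewrite inE; apply/forallP=> y; apply/implyP=> ry.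
by apply/eqP/lower_lt => //; apply: rmax; exact: qle_trans ry.
Qed.

Lemma exists_min (P : quiver) (x : P) : exists2 r, r \in mins P & qle r x.
Proof.
case: (@arg_minnP _ x (fun y => qle y x) (fun y => #|lower y|) (qle_refl x)) => r rx rmin.
exists r => //; rewrite inE; apply/forallP=> y; apply/implyP=> yr.
by apply/eqP/esym/lower_lt => //; apply: rmin; exact: qle_trans rx.
Qed.

Section OrdQuiver.
Variable n : nat.
Definition ord_le : rel 'I_n.+1 := fun i j => i == j.
Definition ord_tot : rel 'I_n.+1 := fun i j => i <= j.

Fact ord_le_refl : reflexive ord_le. Proof. by move=> i; exact: eqxx. Qed.
Fact ord_le_anti : antisymmetric ord_le. Proof. by move=> i j /andP[/eqP]. Qed.
Fact ord_le_trans : transitive ord_le. Proof. by move=> j i k /eqP->. Qed.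
Fact ord_tot_total : total ord_tot. Proof. by move=> i j; exact: leq_total. Qed.
Fact ord_tot_anti : antisymmetric ord_tot.
Proof. by move=> i j h; apply/val_inj/anti_leq. Qed.
Fact ord_tot_trans : transitive ord_tot.
Proof. by move=> j i k; exact: leq_trans. Qed.
Fact ord_le_tot : subrel ord_le ord_tot. Proof. by move=> i j /eqP->; exact: leqnn. Qed.

Definition ord_quiver : quiver :=
  Quiver ord_le_refl ord_le_anti ord_le_trans
         ord_tot_total ord_tot_anti ord_tot_trans ord_le_tot.
End OrdQuiver.

Definition identifies (n : nat) (P : quiver) (f : qhom (ord_quiver n) P)
    (A : {set P}) : Prop :=
  [/\ injective f, f @: [set: ord_quiver n] = A
    & {mono f : i j / qtot i j}].

Record blforest (m n : nat) := BLForest {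
  blf_quiver :> quiver;
  blf_forest : ordered_forest blf_quiver;
  iota_max : qhom (ord_quiver m) blf_quiver;
  iota_min : qhom (ord_quiver n) blf_quiver;
  iota_maxP : identifies iota_max (maxs blf_quiver);
  iota_minP : identifies iota_min (mins blf_quiver)
}.

Definition blf_iso (m n : nat) (F G : blforest m n) : Prop :=
  exists a : qhom F G,
    [/\ qiso a, a \o iota_max F =1 iota_max G & a \o iota_min F =1 iota_min G].

Record ho_blforest (m n : nat) := HOBLForest {
  ho_blf :> blforest m n;
  ho_blfP : height_one_forest ho_blf
}.

Definition iso_class_of (m n : nat) (F : ho_blforest m n) :
    ho_blforest m n -> Prop :=
  fun G => blf_iso F G.

Definition iso_classes (m n : nat) : Type :=
  {C : ho_blforest m n -> Prop | exists F, C = iso_class_of F}.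

Definition iso_class (m n : nat) (F : ho_blforest m n) : iso_classes m n :=
  exist _ (iso_class_of F) (ex_intro _ F erefl).

Definition is_osurj (n m : nat) (f : {ffun 'I_n.+1 -> 'I_m.+1}) : bool :=
  [forall i : 'I_n.+1, forall j : 'I_n.+1, (i <= j) ==> (f i <= f j)] &&
  [forall i : 'I_m.+1, exists j, f j == i].

Definition osurj (n m : nat) : Type :=
  {f : {ffun 'I_n.+1 -> 'I_m.+1} | is_osurj f}.

Lemma osurj_homo n m (s : osurj n m) :
  forall i j : 'I_n.+1, i <= j -> val s i <= val s j.
Proof.
by case: s => f /= /andP[/forallP h _] i j; move: (h i) => /forallP/(_ j)/implyP.
Qed.

Lemma osurj_surj n m (s : osurj n m) (i : 'I_m.+1) : exists j, val s j = i.
Proof.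
by case: s => f /= /andP[_ /forallP/(_ i)/existsP[j /eqP]]; exists j.
Qed.

Section Corolla.
Variables (n : nat) (B : {set 'I_n.+1}).
Definition corolla_sort : finType := option {j : 'I_n.+1 | j \in B}.

(* None is the root and Some j is the leaf indexed by j. *)
Definition corolla_le : rel corolla_sort := fun x y => (y == None) || (x == y).
Definition corolla_tot : rel corolla_sort := fun x y =>
  match x, y with
  | _, None => true
  | None, Some _ => false
  | Some j, Some k => val j <= val k
  end.

Fact corolla_le_refl : reflexive corolla_le.
Proof. by move=> x; rewrite /corolla_le eqxx orbT. Qed.
Fact corolla_le_anti : antisymmetric corolla_le.
Proof.
move=> x y /andP[/orP[/eqP->|/eqP->]] //.
by case/orP=> /eqP->.
Qed.
Fact corolla_le_trans : transitive corolla_le.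
Proof.
move=> y x z; rewrite /corolla_le => h1 /orP[->//|/eqP<-] //.
Qed.
Fact corolla_tot_total : total corolla_tot.
Proof. by move=> [x|] [y|] //=; exact: leq_total. Qed.
Fact corolla_tot_anti : antisymmetric corolla_tot.
Proof. by move=> [x|] [y|] //= /anti_leq h; congr Some; do 2!apply: val_inj. Qed.
Fact corolla_tot_trans : transitive corolla_tot.
Proof. by move=> [y|] [x|] [z|] //=; exact: leq_trans. Qed.
Fact corolla_le_tot : subrel corolla_le corolla_tot.
Proof. by move=> [x|] [y|] //= /orP[//|/eqP[->]]; exact: leqnn. Qed.

Definition corolla : quiver :=
  Quiver corolla_le_refl corolla_le_anti corolla_le_trans
         corolla_tot_total corolla_tot_anti corolla_tot_trans corolla_le_tot.
End Corolla.

Section OrderedSum.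
Variables (k : nat) (Q : 'I_k -> quiver).
Definition osum_sort : finType := {i : 'I_k & Q i}.
Definition osum_le : rel osum_sort := fun u v =>
  (tag u == tag v) && qle (tagged u) (tagged_as u v).
Definition osum_tot : rel osum_sort := fun u v =>
  (tag u < tag v) || (tag u == tag v) && qtot (tagged u) (tagged_as u v).

Fact osum_leE i (x y : Q i) :
  osum_le (existT _ i x) (existT _ i y) = qle x y.
Proof.
rewrite /osum_le /= eqxx /=; congr qle.
exact: (@tagged_asE _ (fun i => Q i) (existT _ i x) y).
Qed.
Fact osum_totE i (x y : Q i) :
  osum_tot (existT _ i x) (existT _ i y) = qtot x y.
Proof.
rewrite /osum_tot /= eqxx ltnn /=; congr qtot.
exact: (@tagged_asE _ (fun i => Q i) (existT _ i x) y).
Qed.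
Fact osum_le_tag u v : osum_le u v -> tag u = tag v.
Proof. by case/andP=> /eqP. Qed.
Fact osum_le_refl : reflexive osum_le.
Proof. by case=> i x; rewrite osum_leE qle_refl. Qed.
Fact osum_le_anti : antisymmetric osum_le.
Proof.
move=> [i x] [j y] h; have /= ij := osum_le_tag (proj1 (andP h)).
by case: _ / ij y h => y; rewrite !osum_leE => /qle_anti->.
Qed.
Fact osum_le_trans : transitive osum_le.
Proof.
move=> [j y] [i x] [l z] h1 h2.
have /= ij := osum_le_tag h1; have /= jl := osum_le_tag h2.
case: _ / jl z h2 => z; case: _ / ij y h1 z => y + z.
by rewrite !osum_leE; exact: qle_trans.
Qed.
Fact osum_tot_total : total osum_tot.
Proof.
move=> [i x] [j y]; case: (ltngtP i j) => [ij|ji|/val_inj ij].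
- by rewrite /osum_tot /= ij.
- by rewrite /osum_tot /= ji orbT.
- by case: _ / ij y => y; rewrite !osum_totE qtot_total.
Qed.
Fact osum_tot_tag u v : osum_tot u v -> tag u < tag v \/ tag u = tag v.
Proof. by case/orP=> [|/andP[/eqP]]; [left|right]. Qed.
Fact osum_tot_anti : antisymmetric osum_tot.
Proof.
move=> [i x] [j y] /andP[h1 h2].
case: (osum_tot_tag h1) (osum_tot_tag h2) => /= [ij|ij].
  by case=> ji; exfalso; [have := ltn_trans ij ji|move: ij; rewrite ji]; rewrite ltnn.
case: _ / ij y h1 h2 => y h1 h2 _; move: h1 h2; rewrite !osum_totE => h1 h2.
by rewrite (qtot_anti (introT andP (conj h1 h2))).
Qed.
Fact osum_tot_trans : transitive osum_tot.
Proof.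
move=> [j y] [i x] [l z] h1 h2.
case: (osum_tot_tag h1) (osum_tot_tag h2) => /= [ij|ij] [jl|jl].
- by rewrite /osum_tot /= (ltn_trans ij jl).
- by apply/orP; left; rewrite /= -jl.
- by apply/orP; left; rewrite /= ij.
case: _ / jl z h2 => z; case: _ / ij y h1 z => y + z.
by rewrite !osum_totE; exact: qtot_trans.
Qed.
Fact osum_le_tot : subrel osum_le osum_tot.
Proof. by move=> u v /andP[h1 h2]; rewrite /osum_tot h1 qle_qtot ?orbT. Qed.

Definition osum : quiver :=
  Quiver osum_le_refl osum_le_anti osum_le_trans
         osum_tot_total osum_tot_anti osum_tot_trans osum_le_tot.
End OrderedSum.

Section ForestOfSurjection.
Variables (m n : nat) (s : osurj n m).

Definition fiber (i : 'I_m.+1) : {set 'I_n.+1} := [set j | val s j == i].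

Fact in_fiber (j : 'I_n.+1) : j \in fiber (val s j).
Proof. by rewrite inE. Qed.

Definition Fquiver : quiver := osum (fun i => corolla (fiber i)).

Definition Froot (i : 'I_m.+1) : Fquiver :=
  existT (fun i => corolla (fiber i) : Type) i None.

Definition Fleaf (j : 'I_n.+1) : Fquiver :=
  existT (fun i => corolla (fiber i) : Type) (val s j) (Some (Sub j (in_fiber j))).

Lemma Fquiver_ind (K : Fquiver -> Prop) :
  (forall i, K (Froot i)) -> (forall j, K (Fleaf j)) -> forall x, K x.
Proof.
move=> hr hl [i [[j hj]|]]; last exact: hr.
have /[!inE]/eqP e := hj; case: _ / e hj => hj.
by have := hl j; rewrite /Fleaf (bool_irrelevance (in_fiber j) hj).
Qed.

Lemma le_root_root i k : qle (Froot i) (Froot k) = (i == k).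
Proof.
apply/idP/eqP => [/osum_le_tag //|->]; exact: qle_refl.
Qed.

Lemma le_leaf_root j i : qle (Fleaf j) (Froot i) = (val s j == i).
Proof.
apply/idP/eqP => [/osum_le_tag //|e].
by case: _ / e; rewrite /= osum_leE.
Qed.

Lemma le_root_leaf i j : qle (Froot i) (Fleaf j) = false.
Proof.
apply/negP => h; have /= e := osum_le_tag h.
by move: h; rewrite e /= osum_leE.
Qed.

Lemma leaf_cast i j (h : j \in fiber i) :
  existT (fun i => corolla (fiber i) : Type) i (Some (Sub j h)) = Fleaf j.
Proof.
have /[!inE]/eqP e := h; case: _ / e h => h.
by rewrite /Fleaf (bool_irrelevance (in_fiber j) h).
Qed.

Lemma le_leaf_leaf j k : qle (Fleaf j) (Fleaf k) = (j == k).
Proof.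
apply/idP/eqP => [h|->]; last exact: qle_refl.
have /= e := osum_le_tag h.
have hk : k \in fiber (val s j) by rewrite inE e.
by move: h; rewrite -(leaf_cast hk) /= osum_leE => /eqP[].
Qed.

Lemma tot_root_root i k : qtot (Froot i) (Froot k) = (i <= k).
Proof.
apply/idP/idP => [/osum_tot_tag[/ltnW //|/= -> //]|].
rewrite leq_eqVlt => /orP[/eqP/val_inj->|ik]; first exact: qle_qtot (qle_refl _).
by rewrite /= /osum_tot /= ik.
Qed.

Lemma tot_leaf_leaf j k : qtot (Fleaf j) (Fleaf k) = (j <= k).
Proof.
have mono (j' k' : 'I_n.+1) : j' <= k' -> qtot (Fleaf j') (Fleaf k').
  move=> jk; have := osurj_homo s jk; rewrite leq_eqVlt => /orP[/eqP/val_inj e|h].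
    have hk : k' \in fiber (val s j') by rewrite inE e.
    by rewrite -(leaf_cast hk) /= osum_totE.
  by rewrite /= /osum_tot /= h.
apply/idP/idP => [h|]; last exact: mono.
case: (leqP j k) => // kj.
have /qtot_anti h2 : qtot (Fleaf j) (Fleaf k) && qtot (Fleaf k) (Fleaf j).
  by rewrite h mono // ltnW.
have : qle (Fleaf j) (Fleaf k) by rewrite h2; exact: qle_refl.
by rewrite le_leaf_leaf => /eqP e; rewrite e ltnn in kj.
Qed.

Lemma le_root u i : qle u (Froot i) = (tag u == i).
Proof.
by elim/Fquiver_ind: u => [k|j]; rewrite ?le_root_root ?le_leaf_root.
Qed.

Lemma tot_tag u v : @qtot Fquiver u v -> tag u <= tag v.
Proof. by case/osum_tot_tag=> [/ltnW|->]. Qed.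

Fact Fquiver_forest : ordered_forest Fquiver.
Proof.
move=> x; elim/Fquiver_ind: x => [i|j] a b c; rewrite !inE.
  rewrite !le_root => /eqP ai /eqP bi /tot_tag h1 /tot_tag h2.
  by apply/eqP/val_inj/anti_leq; rewrite -{1}bi h2 -ai h1.
have low x : qle x (Fleaf j) -> x = Fleaf j.
  elim/Fquiver_ind: x => [i|k]; first by rewrite le_root_leaf.
  by rewrite le_leaf_leaf => /eqP->.
move=> /low-> /low-> h1 h2; rewrite (@qtot_anti Fquiver c (Fleaf j)) ?h1 ?h2 //.
exact: qle_refl.
Qed.

Fact root_max i : Froot i \in maxs Fquiver.
Proof.
rewrite inE; apply/forallP=> y; apply/implyP.
elim/Fquiver_ind: y => [k|j]; last by rewrite le_root_leaf.
by rewrite le_root_root => /eqP->.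
Qed.

Fact leaf_max j : Fleaf j \in maxs Fquiver = false.
Proof.
apply/negP; rewrite inE => /forallP/(_ (Froot (val s j))).
rewrite le_leaf_root eqxx /= => /eqP h.
by have := le_root_leaf (val s j) j; rewrite -h qle_refl.
Qed.

Fact leaf_min j : Fleaf j \in mins Fquiver.
Proof.
rewrite inE; apply/forallP=> y; apply/implyP.
elim/Fquiver_ind: y => [i|k]; first by rewrite le_root_leaf.
by rewrite le_leaf_leaf => /eqP->.
Qed.

Fact root_min i : Froot i \in mins Fquiver = false.
Proof.
apply/negP; rewrite inE => /forallP h; have [j ji] := osurj_surj s i.
have := h (Fleaf j); rewrite le_leaf_root ji eqxx /= => /eqP e.
by have := le_root_leaf i j; rewrite e qle_refl.
Qed.

Fact Fquiver_height_one : height_one_forest Fquiver.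
Proof.
apply: height_oneI Fquiver_forest _ => x.
by elim/Fquiver_ind: x => [i|j]; rewrite ?root_max ?root_min ?leaf_max ?leaf_min.
Qed.

Fact Froot_le : {homo (Froot : ord_quiver m -> Fquiver) : i j / qle i j}.
Proof. by move=> i j /eqP->; exact: qle_refl. Qed.
Fact Froot_tot : {homo (Froot : ord_quiver m -> Fquiver) : i j / qtot i j}.
Proof. by move=> i j h; rewrite tot_root_root. Qed.
Fact Fleaf_le : {homo (Fleaf : ord_quiver n -> Fquiver) : i j / qle i j}.
Proof. by move=> i j /eqP->; exact: qle_refl. Qed.
Fact Fleaf_tot : {homo (Fleaf : ord_quiver n -> Fquiver) : i j / qtot i j}.
Proof. by move=> i j h; rewrite tot_leaf_leaf. Qed.

Definition Froot_hom : qhom (ord_quiver m) Fquiver := QHom Froot_le Froot_tot.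
Definition Fleaf_hom : qhom (ord_quiver n) Fquiver := QHom Fleaf_le Fleaf_tot.

Fact Froot_identifies : identifies Froot_hom (maxs Fquiver).
Proof.
split=> [i k /= h||i k]; last exact: tot_root_root.
  by apply/eqP; rewrite -le_root_root h qle_refl.
apply/setP=> x; apply/imsetP/idP => [[i _ ->]|]; first exact: root_max.
by elim/Fquiver_ind: x => [i _|j]; [exists i|rewrite leaf_max].
Qed.

Fact Fleaf_identifies : identifies Fleaf_hom (mins Fquiver).
Proof.
split=> [i k /= h||i k]; last exact: tot_leaf_leaf.
  by apply/eqP; rewrite -le_leaf_leaf h qle_refl.
apply/setP=> x; apply/imsetP/idP => [[i _ ->]|]; first exact: leaf_min.
by elim/Fquiver_ind: x => [i|j _]; [rewrite root_min|exists j].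
Qed.

Definition forest_of : ho_blforest m n :=
  @HOBLForest m n
    (BLForest Fquiver_forest Froot_identifies Fleaf_identifies)
    Fquiver_height_one.
End ForestOfSurjection.

Section SurjectionOfForest.
Variables (m n : nat) (F : blforest m n).

Definition sigma_fun : {ffun 'I_n.+1 -> 'I_m.+1} :=
  [ffun j => odflt ord0 [pick i | qle (iota_min F j) (iota_max F i)]].

Lemma iota_max_in i : iota_max F i \in maxs F.
Proof. by case: (iota_maxP F) => _ <- _; exact: imset_f. Qed.

Lemma iota_min_in j : iota_min F j \in mins F.
Proof. by case: (iota_minP F) => _ <- _; exact: imset_f. Qed.

Lemma iota_max_uniq x i k :
  qle x (iota_max F i) -> qle x (iota_max F k) -> i = k.
Proof.
wlog ik : i k / i <= k => [th h1 h2|h1 h2].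
  by case/orP: (leq_total i k) => /th; [apply|move=> ->].
case: (iota_maxP F) => inj _ mono; apply: inj.
have : iota_max F i \in lower (iota_max F k).
  apply: (@blf_forest _ _ F _ x (iota_max F k)); rewrite ?inE ?qle_refl //.
    exact: qle_qtot.
  by rewrite mono.
have := iota_max_in i; rewrite !inE => /forallP/(_ (iota_max F k))/implyP h.
by move=> /h/eqP.
Qed.

Lemma sigma_funP j i :
  (sigma_fun j == i) = qle (iota_min F j) (iota_max F i).
Proof.
rewrite ffunE; case: pickP => [k hk|no] /=.
  apply/eqP/idP => [<- //|hi]; exact: iota_max_uniq hk hi.
have [r rmax le_r] := exists_max (iota_min F j).
have : r \in iota_max F @: [set: ord_quiver m] by case: (iota_maxP F) => _ ->.
by case/imsetP=> k _ e; have := no k; rewrite -e le_r.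
Qed.

Fact sigma_fun_osurj : is_osurj sigma_fun.
Proof.
apply/andP; split.
  apply/forallP=> j; apply/forallP=> k; apply/implyP=> jk.
  have := sigma_funP j (sigma_fun j); have := sigma_funP k (sigma_fun k).
  rewrite !eqxx => /esym hk /esym hj; rewrite leqNgt; apply/negP => lt.
  have [_ _ monoM] := iota_maxP F; have [_ _ monom] := iota_minP F.
  have : iota_max F (sigma_fun k) \in lower (iota_max F (sigma_fun j)).
    apply: (@blf_forest _ _ F _ (iota_min F j) (iota_max F (sigma_fun j)));
      rewrite ?inE ?qle_refl //; last by rewrite monoM; exact: ltnW.
    apply: (@qtot_trans F (iota_min F k)); first by rewrite monom.
    exact: qle_qtot.
  rewrite inE => /(qle_trans hk) h.
  by move: lt; rewrite (iota_max_uniq hk h) ltnn.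
apply/forallP=> i; have [x xmin le_x] := exists_min (iota_max F i).
have : x \in iota_min F @: [set: ord_quiver n] by case: (iota_minP F) => _ ->.
by case/imsetP=> j _ e; apply/existsP; exists j; rewrite sigma_funP -e.
Qed.

Definition sigma_of : osurj n m := exist _ sigma_fun sigma_fun_osurj.

Lemma sigma_ofP (j : 'I_n.+1) (i : 'I_m.+1) :
  val sigma_of j = i <-> qle (iota_min F j) (iota_max F i).
Proof. by rewrite -sigma_funP; split=> /eqP. Qed.
End SurjectionOfForest.

(* Main.v *)
Require Import Defs.
From mathcomp Require Import all_boot.
From mathcomp Require boolp.

Set Implicit Arguments.
Unset Strict Implicit.
Unset Printing Implicit Defensive.

(* In a height-one forest the images of iota^+ and iota^- partition F, so     *)
(* r_i |-> iota^+(i) and (leaf j) |-> iota^-(j) define a bijection from       *)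
(* F_{sigma_F} to F. The partial order is determined by sigma_F by            *)
(* definition. So is the total order: if i < sigma_F(j) but                   *)
(* iota^-(j) <= iota^+(i) in the total order, then iota^+(i) lies between     *)
(* iota^-(j) and iota^+(sigma_F(j)), and the interval condition forces        *)
(* iota^+(i) <= iota^+(sigma_F(j)) in the partial order, contradicting        *)
(* maximality.                                                                *)

(** For a surjection [s], leaf [j] of [forest_of s] lies below root [val s j], so [sigma_of]
    recovers [s] ([sigma_of_forest_of]). Conversely, [canonical_map] is an isomorphism compatible
    with both labellings ([forest_of_sigma_of]). Since [sigma_of] is invariant under labelled
    isomorphism ([sigma_of_iso]), it descends to classes. *)

Lemma mins_eq (P : quiver) (x y : P) : y \in mins P -> qle x y -> x = y.
Proof. by rewrite inE => /forallP/(_ x)/implyP h /h/eqP. Qed.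

Lemma maxs_eq (P : quiver) (x y : P) : x \in maxs P -> qle x y -> y = x.
Proof. by rewrite inE => /forallP/(_ y)/implyP h /h/eqP. Qed.

Lemma mins_lower (P : quiver) (r : P) (x : subquiver (lower r)) :
  (x \in mins (subquiver (lower r))) = (val x \in mins P).
Proof.
have xr : qle (val x) r by have := valP x; rewrite inE.
apply/idP/idP=> xmin; rewrite inE; apply/forallP=> y; apply/implyP=> yx.
  have yr : y \in lower r by rewrite inE (qle_trans yx).
  by rewrite -(@mins_eq _ (Sub y yr : subquiver (lower r)) _ xmin yx).
by apply/eqP/val_inj; exact: mins_eq xmin yx.
Qed.

Lemma maxs_lower (P : quiver) (r : P) (x : subquiver (lower r)) :
  r \in maxs P -> (x \in maxs (subquiver (lower r))) = (val x \in maxs P).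
Proof.
move=> rmax; have xr : qle (val x) r by have := valP x; rewrite inE.
have rr : r \in lower r by rewrite inE qle_refl.
apply/idP/idP=> xmax.
  by rewrite -(@maxs_eq _ _ (Sub r rr : subquiver (lower r)) xmax xr).
rewrite inE; apply/forallP=> y; apply/implyP=> xy.
by apply/eqP/val_inj; exact: maxs_eq xmax xy.
Qed.

(** Each [x] lies under some maximal [r]. Minimality in [lower r] agrees with minimality in [P]
    because [lower r] is down-closed, and maximality agrees because [r] is maximal. *)
Lemma height_one_min_max (P : quiver) (x : P) :
  height_one_forest P -> (x \in mins P) (+) (x \in maxs P).
Proof.
case=> _ ho; have [r rmax xr] := exists_max x.
have xl : x \in lower r by rewrite inE.
have [_ /(_ (Sub x xl : subquiver (lower r)))] := ho r rmax.
by rewrite mins_lower maxs_lower.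
Qed.

Lemma qhom_tot_inj_mono (P Q : quiver) (f : P -> Q) :
  injective f -> {homo f : x y / qtot x y} -> {mono f : x y / qtot x y}.
Proof.
move=> inj homo x y; apply/idP/idP=> [fxy|]; last exact: homo.
case/orP: (qtot_total x y) => // yx.
have -> : x = y by apply/inj/qtot_anti; rewrite fxy homo.
exact/qle_qtot/qle_refl.
Qed.

Lemma qle_mono_inj (P Q : quiver) (f : P -> Q) :
  {mono f : x y / qle x y} -> injective f.
Proof.
by move=> mono x y e; apply: qle_anti; rewrite -!mono e qle_refl.
Qed.

(** Reflecting the partial order gives injectivity, and totality then makes [f] reflect the total
    order, so the inverse map preserves both orders. *)
Lemma mono_surj_qiso (P Q : quiver) (f : qhom P Q) :
  {mono f : x y / qle x y} -> (forall y, exists x, f x = y) -> qiso f.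
Proof.
move=> mono surj; have inj := qle_mono_inj mono.
have monot := qhom_tot_inj_mono inj (qhom_tot f).
have ex y : exists x, f x == y by have [x <-] := surj y; exists x.
pose g y := xchoose (ex y).
have gK : cancel g f by move=> y; exact/eqP/(xchooseP (ex y)).
have gle : {homo g : x y / qle x y} by move=> x y; rewrite -mono !gK.
have gtot : {homo g : x y / qtot x y} by move=> x y; rewrite -monot !gK.
by exists (QHom gle gtot); split=> // x; apply: inj; rewrite /= gK.
Qed.

Section Isomorphism.
Variables m n : nat.
Implicit Types F G H : blforest m n.

Lemma blf_iso_refl F : blf_iso F F.
Proof.
have le1 : {homo (id : F -> F) : x y / qle x y} by [].
have tot1 : {homo (id : F -> F) : x y / qtot x y} by [].
by exists (QHom le1 tot1); split=> //; exists (QHom le1 tot1).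
Qed.

Lemma blf_iso_sym F G : blf_iso F G -> blf_iso G F.
Proof.
case=> a [[b [aK bK]] amax amin]; exists b; split; first by exists a.
  by move=> i; rewrite /= -amax /= aK.
by move=> j; rewrite /= -amin /= aK.
Qed.

Lemma blf_iso_trans F G H : blf_iso F G -> blf_iso G H -> blf_iso F H.
Proof.
move=> [a [[a' [aK a'K]] amax amin]] [b [[b' [bK b'K]] bmax bmin]].
have homo_comp (P Q R : quiver) (f : qhom P Q) (g : qhom Q R) :
    {homo g \o f : x y / qle x y} /\ {homo g \o f : x y / qtot x y}.
  by split=> x y h /=; do 2!(apply: qhom_le || apply: qhom_tot).
have [le tot] := homo_comp _ _ _ a b.
have [le' tot'] := homo_comp _ _ _ b' a'.
exists (QHom le tot); split.
- by exists (QHom le' tot'); split=> x /=; rewrite ?bK ?aK ?a'K ?b'K.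
- by move=> i /=; rewrite -bmax /= -amax.
by move=> j /=; rewrite -bmin /= -amin.
Qed.

(** Classes are predicates packed with a proof, so their equality rests on functional and
    propositional extensionality and proof irrelevance. *)
Lemma iso_class_eq (F G : ho_blforest m n) :
  blf_iso F G -> iso_class F = iso_class G.
Proof.
move=> FG; apply: boolp.eq_exist; apply: boolp.funext => H.
rewrite boolp.propeqE; split; last exact: blf_iso_trans.
by apply: blf_iso_trans; exact: blf_iso_sym.
Qed.

Lemma iso_class_inj (F G : ho_blforest m n) :
  iso_class F = iso_class G -> blf_iso F G.
Proof.
case=> FG; rewrite -[blf_iso F G]/(iso_class_of F G) FG.
exact: blf_iso_refl.
Qed.

Lemma sigma_of_eq F (s : osurj n m) :
  (forall j, qle (iota_min F j) (iota_max F (val s j))) -> sigma_of F = s.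
Proof.
move=> h; apply/val_inj/ffunP => j.
exact/sigma_ofP/h.
Qed.

Lemma sigma_of_iso F G : blf_iso F G -> sigma_of F = sigma_of G.
Proof.
case=> a [[b [aK bK]] amax amin]; apply: sigma_of_eq => j.
rewrite -[iota_min F j]aK -[iota_max F _]aK; apply: qhom_le.
have /= -> := amin j; have /= -> := amax (sigma_fun G j).
by rewrite -sigma_funP.
Qed.

Lemma sigma_of_forest_of (s : osurj n m) : sigma_of (forest_of s) = s.
Proof. by apply: sigma_of_eq => j; have := le_leaf_root s j (val s j); rewrite eqxx. Qed.

End Isomorphism.

Section CanonicalForm.
Variables (m n : nat) (F : ho_blforest m n).

Let s := sigma_of F.

Definition canonical_map (u : Fquiver s) : F :=
  match tagged u with
  | None => iota_max F (tag u)
  | Some j => iota_min F (val j)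
  end.

Lemma canonical_map_root i : canonical_map (Froot s i) = iota_max F i.
Proof. by []. Qed.

Lemma canonical_map_leaf j : canonical_map (Fleaf s j) = iota_min F j.
Proof. by []. Qed.

Lemma canonical_map_le : {mono canonical_map : u v / qle u v}.
Proof.
have [injM _ _] := iota_maxP F; have [injm _ _] := iota_minP F.
move=> u v; elim/Fquiver_ind: u => [i|j]; elim/Fquiver_ind: v => [k|k];
  rewrite ?canonical_map_root ?canonical_map_leaf.
- rewrite le_root_root; apply/idP/eqP=> [h|->]; last exact: qle_refl.
  by apply/esym/injM/(maxs_eq _ h)/iota_max_in.
(* A root below a leaf would equal it, hence be both minimal and maximal. *)
- rewrite le_root_leaf; apply/negP=> h.
  have e := mins_eq (iota_min_in F k) h.
  have := height_one_min_max (iota_max F i) (ho_blfP F).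
  by rewrite iota_max_in e iota_min_in.
- by rewrite le_leaf_root -sigma_funP.
rewrite le_leaf_leaf; apply/idP/eqP=> [h|->]; last exact: qle_refl.
by apply/injm/(mins_eq _ h)/iota_min_in.
Qed.

Lemma canonical_map_tot : {homo canonical_map : u v / qtot u v}.
Proof.
have [_ _ monoM] := iota_maxP F; have [_ _ monom] := iota_minP F.
have le_s j : qle (iota_min F j) (iota_max F (val s j)) by rewrite -sigma_funP.
move=> u v; elim/Fquiver_ind: u => [i|j]; elim/Fquiver_ind: v => [k|k] h;
  rewrite ?canonical_map_root ?canonical_map_leaf.
- by rewrite monoM /= /ord_tot -(tot_root_root s).
(* If the leaf came first, the interval condition would force [i = val s k]; but in a corolla the
   root never precedes its own leaf. *)
- case/orP: (qtot_total (iota_max F i) (iota_min F k)) => // ki.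
  have isk : i <= val s k := tot_tag h.
  have : iota_max F i \in lower (iota_max F (val s k)).
    apply: (@blf_forest _ _ F _ (iota_min F k) (iota_max F (val s k))) => //.
    - by rewrite inE.
    - by rewrite inE qle_refl.
    - by rewrite monoM.
  rewrite inE => /(iota_max_uniq (qle_refl _)) e.
  have hk : k \in fiber s i by rewrite inE -e.
  by move: h; rewrite -(leaf_cast hk) /= osum_totE.
(* Pass through the root above leaf [j]. *)
- apply: qtot_trans (qle_qtot (le_s j)) _; rewrite monoM.
  exact: (tot_tag h).
by rewrite monom /= /ord_tot -(tot_leaf_leaf s).
Qed.

Lemma canonical_map_surj (x : F) : exists u, canonical_map u = x.
Proof.
have [_ imM _] := iota_maxP F; have [_ imm _] := iota_minP F.
have := height_one_min_max x (ho_blfP F); case: (boolP (x \in mins F)).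
  by rewrite -imm => /imsetP[j _ ->] _; exists (Fleaf s j).
by move=> _ /=; rewrite -imM => /imsetP[i _ ->]; exists (Froot s i).
Qed.

Lemma forest_of_sigma_of : blf_iso (forest_of (sigma_of F)) F.
Proof.
have le : {homo canonical_map : u v / qle u v}.
  by move=> u v; rewrite canonical_map_le.
exists (QHom le canonical_map_tot : qhom (forest_of s) F); split=> //.
apply: mono_surj_qiso; first exact: canonical_map_le.
exact: canonical_map_surj.
Qed.

End CanonicalForm.

Theorem proposition3p4 (m n : nat) :
  exists (Phi : osurj n m -> iso_classes m n)
         (Psi : iso_classes m n -> osurj n m),
    [/\ forall s : osurj n m, Phi s = iso_class (forest_of s),
        forall F : ho_blforest m n, Psi (iso_class F) = sigma_of F,
        cancel Phi Psi
      & cancel Psi Phi].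
Proof.
(* Choose a representative of each class; [PsiE] shows that the choice does not affect the
   surjection. *)
have rep (C : iso_classes m n) : {F | C = iso_class F}.
  by apply: boolp.cid; case: C => C [F eC]; exists F; exact: boolp.eq_exist.
pose Psi C := sigma_of (sval (rep C)).
have PsiE F : Psi (iso_class F) = sigma_of F.
  rewrite /Psi; case: (rep _) => G /= /iso_class_inj FG.
  exact/esym/sigma_of_iso.
exists (fun s => iso_class (forest_of s)), Psi; split=> // [s|C].
  by rewrite PsiE sigma_of_forest_of.
have [F ->] := rep C; rewrite PsiE.
exact/iso_class_eq/forest_of_sigma_of.
Qed.
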